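(* Let $x$ be a complex number with $|x|<1$ and let $\ell \ge 1$ be an integer. Let $a_{\ell,i}$ denote the coefficient of $k^{i}$ in the polynomial $\prod_{j=0}^{\ell-1} (k^2-j^2)$ (in the variable $k$), and let $b_{\ell,i}$ denote the coefficient of $k^{i}$ in the polynomial $(2k+1)\prod_{j=0}^{\ell-1} (k-j)(k+1+j)$. Then \[ a_{\ell,2\ell}\, \mathrm{Li}_{-2\ell}(x) + a_{\ell,2\ell-1}\, \mathrm{Li}_{-2\ell+1}(x) + \cdots + a_{\ell,0}\, \mathrm{Li}_{0}(x) \;=\; \frac{(2\ell)!}{2}\cdot \frac{x^\ell(1+x)}{(1-x)^{2\ell+1}}, \] and \[ b_{\ell,2\ell+1}\, \mathrm{Li}_{-2\ell-1}(x) + b_{\ell,2\ell}\, \mathrm{Li}_{-2\ell}(x) + \cdots + b_{\ell,0}\, \mathrm{Li}_{0}(x) \;=\; (2\ell+1)!\cdot \frac{x^\ell(1+x)}{(1-x)^{2\ell+2}}. \] That is, $\sum_{i=0}^{2\ell} a_{\ell,i}\mathrm{Li}_{-i}(x)$ and $\sum_{i=0}^{2\ell+1} b_{\ell,i}\mathrm{Li}_{-i}(x)$ equal the stated rational functions.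
   Context: For an integer $r \ge 0$ and $|x|<1$, the polylogarithm function is $\mathrm{Li}_{-r}(x) = \sum_{k=1}^\infty k^{r} x^k$ (in general $\mathrm{Li}_s(x)=\sum_{k=1}^\infty k^{-s}x^k$). *)

(* Defs.v *)
From mathcomp Require Import all_boot all_order all_algebra.
From mathcomp Require Import complex.
From mathcomp Require Import all_classical all_reals all_analysis.

Set Implicit Arguments.
Unset Strict Implicit.
Unset Printing Implicit Defensive.

Import Order.TTheory GRing.Theory Num.Theory.
Import numFieldNormedType.Exports.

Local Open Scope classical_set_scope.
Local Open Scope complex_scope.
Local Open Scope ring_scope.

(* The polylogarithm sum_(k >= 1) k^(-s) x^k for integer s; index n of the
   sequence is the term k = n + 1.  The cast to R[i]^o selects the normed
   topology of the complex plane.  Like any limn, the value is meaningful only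
   where the series converges, in particular for |x| < 1. *)
Definition Li (R : realType) (s : int) (x : R[i]) : R[i] :=
  limn (series (fun n : nat => (n.+1%:R ^ (- s) * x ^+ n.+1 : R[i]^o))).

Definition a_poly (R : realType) (l : nat) : {poly R[i]} :=
  \prod_(0 <= j < l) ('X ^+ 2 - (j%:R ^+ 2)%:P).

Definition b_poly (R : realType) (l : nat) : {poly R[i]} :=
  (2%:R *: 'X + 1) *
  \prod_(0 <= j < l) (('X - j%:R%:P) * ('X + 1 + j%:R%:P)).

Definition a_coef (R : realType) (l i : nat) : R[i] := (a_poly R l)`_i.

Definition b_coef (R : realType) (l i : nat) : R[i] := (b_poly R l)`_i.

(* Main.v *)
(* On integers [k] both polynomials are, up to a factor, sums of two adjacent
   binomial coefficients: [C(k+l, 2l) + C(k+l-1, 2l)] for [a] and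
   [C(k+l+1, 2l+1) + C(k+l, 2l+1)] for [b].  So both identities reduce to
   [sum_k C(k+s, m) x^k = x^(m-s) / (1-x)^(m+1)] for [s <= m]. *)
Require Import Defs.
From mathcomp Require Import all_boot all_order all_algebra.
From mathcomp Require Import complex zify ring.
From mathcomp Require Import all_classical all_reals all_analysis.

Import Order.TTheory GRing.Theory Num.Theory.
Import numFieldNormedType.Exports.

Local Open Scope complex_scope.
Local Open Scope ring_scope.
Local Open Scope classical_set_scope.

(** The limit is the fixed point of [L = x * L + l], and each step contracts the error by [|x|] up
    to the error of [v]. That the powers of [|x|] tend to [0] is a hypothesis because [K] may be
    non-archimedean. *)
Lemma affine_recurrence_cvg (K : numFieldType) (x l : K) (u v : K^nat) :
  `|x| < 1 -> `|x| ^+ n @[n --> \oo] --> (0 : K) ->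
  (forall n, u n.+1 = x * u n + v n) -> v @ \oo --> l ->
  u @ \oo --> l / (1 - x).
Proof.
move=> x1 xn0 uS vl.
have Bx0 : 1 - x != 0.
  by rewrite subr_eq0; apply: contraTneq x1 => <-; rewrite normr1 ltxx.
set L := l / (1 - x).
have LE : L = x * L + l.
  by rewrite /L; field.
apply/cvgrPdist_le => e e0.
have e20 : 0 < e / 2 by rewrite divr_gt0.
(* With this tolerance on [v], the errors accumulated along the geometric series stay below
   [e / 2]. *)
have d0 : 0 < e / 2 * (1 - `|x|) by rewrite mulr_gt0// subr_gt0.
move/cvgrPdist_le : vl => /(_ _ d0) [N _ vN].
have uN k : `|L - u (N + k)%N| <= `|x| ^+ k * `|L - u N| + e / 2.
  elim: k => [|k IH]; first by rewrite addn0 expr0 mul1r lerDl ltW.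
  rewrite addnS uS.
  have -> : L - (x * u (N + k)%N + v (N + k)%N) =
      x * (L - u (N + k)%N) + (l - v (N + k)%N) by rewrite {1}LE; ring.
  have -> : `|x| ^+ k.+1 * `|L - u N| + e / 2 =
      `|x| * (`|x| ^+ k * `|L - u N| + e / 2) + e / 2 * (1 - `|x|).
    by rewrite exprS; ring.
  rewrite (le_trans (ler_normD _ _))// normrM lerD ?ler_wpM2l//.
  by apply: vN; rewrite /= leq_addr.
(* The [+ 1] keeps the denominator positive even when [u N] equals [L]. *)
have a0 : 0 < e / 2 / (`|L - u N| + 1) by rewrite divr_gt0// ltr_wpDl.
move/cvgrPdist_le : xn0 => /(_ _ a0) [M _ xM].
exists (N + M)%N => // n /= NMn.
have Nn : (N <= n)%N by rewrite (leq_trans _ NMn)// leq_addr.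
rewrite -(subnKC Nn) (le_trans (uN _))// [leRHS]splitr lerD2r.
have := xM (n - N)%N; rewrite /= leq_subRL// => /(_ NMn).
rewrite sub0r normrN normrX normr_id ler_pdivlMr ?ltr_wpDl//.
by apply: le_trans; rewrite ler_wpM2l ?exprn_ge0// lerDl.
Qed.

Lemma series_shift_rec (K : numFieldType) (x : K) (c : K^nat) n :
  series (fun k => c k * x ^+ k) n.+1 =
  c 0 + x * series (fun k => c k.+1 * x ^+ k) n.
Proof.
rewrite /series /= big_nat_recl// expr0 mulr1 mulr_sumr; congr (_ + _).
by apply: eq_bigr => k _; rewrite exprS; ring.
Qed.

(* Splitting off the first term and Pascal's rule turn the partial sums for
   [m.+1] into an affine recurrence driven by the partial sums for [m]. *)
Lemma binomial_series (K : numFieldType) (x : K) s m :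
  `|x| < 1 -> `|x| ^+ n @[n --> \oo] --> (0 : K) -> (s <= m)%N ->
  series (fun k => 'C(k + s, m)%:R * x ^+ k) @ \oo -->
    x ^+ (m - s) / (1 - x) ^+ m.+1.
Proof.
move=> x1 xn0.
have Bx0 : 1 - x != 0.
  by rewrite subr_eq0; apply: contraTneq x1 => <-; rewrite normr1 ltxx.
elim: s m => [|s IHs] m sm.
  rewrite subn0; elim: m {sm} => [|m IHm].
    rewrite expr0 expr1.
    apply: (@affine_recurrence_cvg _ x 1 _ (fun=> 1)) => // [n|]; last first.
      exact: cvg_cst.
    rewrite series_shift_rec addrC bin0; congr (_ * _ + _).
    by rewrite /series /=; apply: eq_bigr => k _; rewrite !bin0.
  rewrite [X in _ --> X](_ : _ =
    (x * (x ^+ m / (1 - x) ^+ m.+1)) / (1 - x)); last first.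
    by rewrite !exprS; field; rewrite Bx0 expf_neq0.
  apply: (@affine_recurrence_cvg _ x _ _
      (fun n => x * series (fun k => 'C(k + 0, m)%:R * x ^+ k) n)) => // [n|];
      last exact: cvgMl_tmp.
  rewrite series_shift_rec bin0n add0r -mulrDr; congr (_ * _).
  rewrite /series /= -big_split; apply: eq_bigr => k _ /=.
  by rewrite addSn binS natrD mulrDl.
(* Pascal's rule now lowers the shift: [C(k+s+1, m+1) = C(k+s, m+1) + C(k+s, m)]. *)
case: m sm => [//|m] sm; rewrite subSS.
rewrite [X in _ --> X](_ : _ =
  x ^+ (m.+1 - s) / (1 - x) ^+ m.+2 + x ^+ (m - s) / (1 - x) ^+ m.+1).
  rewrite [X in X @ _](_ : _ =
    series (fun k => 'C(k + s, m.+1)%:R * x ^+ k) \+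
    series (fun k => 'C(k + s, m)%:R * x ^+ k)).
    by apply: cvgD; apply: IHs => //; exact: ltnW.
  apply/funext => n; rewrite /series /= -big_split; apply: eq_bigr => k _ /=.
  by rewrite addnS binS natrD mulrDl.
by rewrite subSn// !exprS; field; rewrite Bx0 expf_neq0.
Qed.

(** The identity [k C(k, m) = (m+1) C(k, m+1) + m C(k, m)] trades one power of [k] for binomial
    coefficients, so the induction on [r] needs every [m] at once. *)
Lemma is_cvg_binomial_moment_series (K : numFieldType) (x : K) (r m : nat) :
  `|x| < 1 -> `|x| ^+ n @[n --> \oo] --> (0 : K) ->
  cvgn (series (fun k => k%:R ^+ r * 'C(k, m)%:R * x ^+ k)).
Proof.
move=> x1 xn0; elim: r m => [m|r IHr m].
  have := @binomial_series _ x 0 m x1 xn0 (leq0n m) => /cvgP.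
  suff -> : (fun k => 'C(k + 0, m)%:R * x ^+ k) =
            (fun k => k%:R ^+ 0 * 'C(k, m)%:R * x ^+ k) by [].
  by apply/funext => k; rewrite expr0 mul1r addn0.
set u := fun j => series (fun k => k%:R ^+ r * 'C(k, j)%:R * x ^+ k).
have ucvg j : cvgn (u j) by exact: IHr.
rewrite [X in cvgn X](_ : _ =
    (fun n => m.+1%:R * u m.+1 n) + (fun n => m%:R * u m n)).
  by apply: is_cvgD; apply: is_cvgMl_tmp.
apply/funext => n; rewrite /u /series /= fctE !mulr_sumr -big_split /=.
apply: eq_bigr => k _; rewrite exprSr.
have kC : k%:R * 'C(k, m)%:R =
    m.+1%:R * 'C(k, m.+1)%:R + m%:R * 'C(k, m)%:R :> K.
  rewrite -!natrM -natrD; congr _%:R.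
  rewrite mul_bin_left -mulnDl.
  by have [km|/subnK->//] := ltnP k m; rewrite bin_small// !muln0.
by rewrite -(mulrA _ k%:R) kC; ring.
Qed.

Lemma series_shift_cvg (K : numFieldType) (u : K^nat) (l : K) :
  series u @ \oo --> l -> series (fun n => u n.+1) @ \oo --> l - u 0.
Proof.
rewrite -cvg_shiftS => ul.
rewrite [X in X @ _](_ : _ = (fun n => series u n.+1 - u 0)).
  by apply: cvgB => //; exact: cvg_cst.
apply/funext => n.
by rewrite /series /= [in RHS]big_nat_recl// addrAC subrr add0r.
Qed.

Lemma is_cvg_monomial_series (K : numFieldType) (x : K) (r : nat) :
  `|x| < 1 -> `|x| ^+ n @[n --> \oo] --> (0 : K) ->
  cvgn (series (fun k => k.+1%:R ^+ r * x ^+ k.+1)).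
Proof.
move=> x1 xn0; have := @is_cvg_binomial_moment_series _ x r 0 x1 xn0.
rewrite (_ : (fun k => _) = (fun k => k%:R ^+ r * x ^+ k)); last first.
  by apply/funext => k; rewrite bin0 mulr1.
by move/series_shift_cvg/cvgP.
Qed.

(** No bound on [m] is required: if [n < m], where truncated subtraction would differ, both sides
    vanish. *)
Lemma ffact_natrS (K : pzRingType) (n m : nat) :
  (n ^_ m.+1)%:R = (n ^_ m)%:R * (n%:R - m%:R) :> K.
Proof.
rewrite ffactnSr natrM; have [nm|mn] := ltnP n m; last by rewrite natrB.
by rewrite ffact_small// !mul0r.
Qed.

(** The factors are the [2l] consecutive integers from [k-l+1] to [k+l]; each new [j] adds one at
    either end. *)
Lemma prod_rising_falling (K : comPzRingType) (k l : nat) :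
  \prod_(0 <= j < l) ((k%:R - j%:R) * (k%:R + 1 + j%:R)) =
  ((k + l) ^_ (2 * l))%:R :> K.
Proof.
elim: l => [|l IH]; first by rewrite big_geq// muln0 ffactn0.
rewrite big_nat_recr//= IH addnS mulnS add2n ffactSS natrM ffact_natrS.
by rewrite -natr1 (natrM _ 2) !natrD; ring.
Qed.

(** The index [j = 0] gives [k^2]: one [k] stays in front, the other fills the middle of the run
    from [k-l] to [k+l]. *)
Lemma prod_sqr_diff (K : comPzRingType) (k l : nat) :
  \prod_(0 <= j < l.+1) (k%:R ^+ 2 - j%:R ^+ 2) =
  k%:R * ((k + l) ^_ (2 * l).+1)%:R :> K.
Proof.
elim: l => [|l IH]; first by rewrite big_nat1 addn0 ffactn1; ring.
rewrite big_nat_recr//= IH addnS mulnS add2n ffactSS natrM.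
rewrite (ffact_natrS _ _ (2 * l).+1) -!natr1 (natrM _ 2) !natrD; ring.
Qed.

(* The vanishing at [0] lets the sum start at [k = 0], although the
   polylogarithm of order [0] has no term at [k = 0]. *)
Lemma sum_coef_polylog (K : numFieldType) (p : {poly K}) (n : nat) (x l : K) :
  `|x| < 1 -> `|x| ^+ n @[n --> \oo] --> (0 : K) ->
  (size p <= n)%N -> p.[0] = 0 ->
  series (fun k => p.[k%:R] * x ^+ k) @ \oo --> l ->
  \sum_(0 <= i < n)
    p`_i * limn (series (fun k => k.+1%:R ^+ i * x ^+ k.+1)) = l.
Proof.
move=> x1 xn0 pn p0 /series_shift_cvg; rewrite p0 mul0r subr0 => /cvg_lim <-//.
apply/esym/cvg_lim => //.
(* On partial sums the two finite sums can be exchanged; the limit then passes through the sum over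
   [i], since each monomial series converges. *)
rewrite [X in X @ _](_ : _ = (fun N => \sum_(i < n)
  p`_i * series (fun k => k.+1%:R ^+ i * x ^+ k.+1) N)).
  rewrite big_mkord; apply: cvg_big => [|i _]; first exact: add_continuous.
  by apply: cvgMl_tmp; exact: is_cvg_monomial_series.
apply/funext => N; rewrite /series /=.
under [RHS]eq_bigr do rewrite mulr_sumr.
rewrite exchange_big; apply: eq_bigr => k _ /=.
rewrite (horner_coef_wide _ pn) mulr_suml.
by apply: eq_bigr => i _; rewrite mulrA.
Qed.

Lemma expn_cvg0_complex (R : realType) (x : R[i]) :
  `|x| < 1 -> `|x| ^+ n @[n --> \oo] --> (0 : R[i]^o).
Proof.
move=> x1; have [r r0 xr] : exists2 r : R, 0 <= r & `|x| = r%:C.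
  by rewrite normc_def; eexists; last reflexivity; rewrite sqrtr_ge0.
move: x1; rewrite xr ltcR => r1.
have rn0 : r ^+ n @[n --> \oo] --> (0 : R).
  by apply: cvg_expr; rewrite ger0_norm.
(* A positive [e] in [R[i]] has zero imaginary part, so the real estimate applies. *)
apply/(@cvgrPdist_le _ R[i]^o) => -[e e'] /=; rewrite ltcE /= => /andP[/eqP -> e0].
move/cvgrPdist_le : rn0 => /(_ _ e0) [N _ rN].
exists N => // n Nn; rewrite sub0r normrN.
have := rN n Nn; rewrite sub0r normrN -rmorphXn normc_def /= expr0n addr0.
by rewrite sqrtr_sqr -[e +i* 0]/(e%:C) lecR.
Qed.

(** Both binomials share the falling factorial of [k+l-1] of length [2l-1]; the remaining factors
    add up to [(k+l) + (k-l) = 2k], whence the division by [2]. *)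
Lemma a_poly_nat (R : realType) (k l : nat) : (0 < l)%N ->
  (a_poly R l).[k%:R] =
  ((2 * l)`!)%:R / 2%:R * ('C(k + l, 2 * l)%:R + 'C(k + l.-1, 2 * l)%:R).
Proof.
case: l => // l _; rewrite /a_poly horner_prod.
under eq_bigr do rewrite !hornerE.
rewrite prod_sqr_diff -[LHS](mulfK (x := 2%:R)) ?pnatr_eq0// [RHS]mulrAC.
congr (_ / _) => /=.
rewrite [RHS]mulrDr -2![in RHS]natrM -2!(mulnC 'C(_, _)) 2!bin_ffact.
rewrite mulnS add2n addnS ffactSS natrM (ffact_natrS _ _ (2 * l).+1).
rewrite -[(k + l).+1%:R]natr1 -[(2 * l).+1%:R]natr1 (natrM _ 2) natrD; ring.
Qed.

(** Here the shared factor is the falling factorial of [k+l] of length [2l], and the rest is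
    [(k+l+1) + (k-l) = 2k+1]. *)
Lemma b_poly_nat (R : realType) (k l : nat) :
  (b_poly R l).[k%:R] =
  ((2 * l + 1)`!)%:R *
  ('C(k + l.+1, (2 * l).+1)%:R + 'C(k + l, (2 * l).+1)%:R).
Proof.
rewrite /b_poly hornerM horner_prod.
under eq_bigr do rewrite !hornerE.
rewrite prod_rising_falling !hornerE addn1.
rewrite mulrDr -2![in RHS]natrM -2!(mulnC 'C(_, _)) 2!bin_ffact.
rewrite addnS ffactSS natrM (ffact_natrS _ _ (2 * l)).
rewrite -[(k + l).+1%:R]natr1 (natrM _ 2) natrD; ring.
Qed.

Lemma size_prod_quadratic (K : nzRingType) (q : {poly K}) (r : nat -> {poly K}) l :
  (forall j, (size (r j) <= 3)%N) ->
  (size (q * \prod_(0 <= j < l) r j)%R <= size q + 2 * l)%N.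
Proof.
move=> r3; elim: l => [|l IH]; first by rewrite big_geq// mulr1 muln0 addn0.
rewrite big_nat_recr//= mulrA; apply: leq_trans (size_polyMleq _ _) _.
rewrite -subn1 leq_subLR; apply: leq_trans (leq_add IH (r3 l)) _.
by rewrite mulnS; move: (size q) => n; lia.
Qed.

Lemma size_a_poly (R : realType) (l : nat) : (size (a_poly R l) <= (2 * l).+1)%N.
Proof.
have := @size_prod_quadratic R[i] 1 (fun j => 'X ^+ 2 - (j%:R ^+ 2)%:P) l.
by rewrite mul1r size_poly1; apply=> j; rewrite size_XnsubC.
Qed.

Lemma size_b_poly (R : realType) (l : nat) :
  (size (b_poly R l) <= (2 * l + 1).+1)%N.
Proof.
apply: leq_trans (@size_prod_quadratic _ (2%:R *: 'X + 1) _ l _) _ => [j|].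
  have -> : 'X + 1 + j%:R%:P = 'X - (- (1 + j%:R))%:P :> {poly R[i]}.
    by rewrite polyCN opprK polyCD addrA.
  by apply: leq_trans (size_polyMleq _ _) _; rewrite !size_XsubC.
rewrite addn1 -[(_ * _).+2]add2n leq_add2r (leq_trans (size_polyD _ _))//.
rewrite size_poly1 geq_max andbT.
by rewrite (leq_trans (size_scale_leq _ _))// size_polyX.
Qed.

Lemma sum_coef_Li (R : realType) (p : {poly R[i]}) (n s m : nat) (x c : R[i]) :
  `|x| < 1 -> (size p <= n)%N -> (s.+1 < m)%N ->
  (forall k, p.[k%:R] = c * ('C(k + s.+1, m)%:R + 'C(k + s, m)%:R)) ->
  \sum_(0 <= i < n) p`_i * Li (- i%:Z) x =
  c * (x ^+ (m - s.+1) * (1 + x) / (1 - x) ^+ m.+1).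
Proof.
move=> x1 pn sm pE; have xn0 := @expn_cvg0_complex R x x1.
(* Since [s.+1 < m], both binomials vanish at [k = 0]. *)
have p0 : p.[0] = 0.
  rewrite -[X in p.[X]]/(0%:R) pE.
  by rewrite !add0n !bin_small ?addr0 ?mulr0// ltnW.
apply: etrans (@sum_coef_polylog _ p n x _ x1 xn0 pn p0 _).
  by apply: eq_bigr => i _; rewrite /Li opprK.
rewrite [X in X @ _](_ : _ = (fun N => c *
    (series (fun k => 'C(k + s.+1, m)%:R * x ^+ k) N +
     series (fun k => 'C(k + s, m)%:R * x ^+ k) N))); last first.
  apply/funext => N; rewrite /series /= -big_split mulr_sumr.
  by apply: eq_bigr => k _; rewrite pE /=; ring.
(* The two generating functions differ by one power of [x], which produces the factor [1 + x]. *)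
have -> : x ^+ (m - s.+1) * (1 + x) / (1 - x) ^+ m.+1 =
    x ^+ (m - s.+1) / (1 - x) ^+ m.+1 + x ^+ (m - s) / (1 - x) ^+ m.+1.
  by rewrite -(subnSK (ltnW sm)) [x ^+ _.+1]exprS; ring.
apply: cvgMl_tmp; apply: cvgD; apply: binomial_series => //; apply: ltnW => //.
exact: ltnW.
Qed.

Theorem theorem1p1 (R : realType) (x : R[i]) (l : nat)
  (hx : `|x| < 1) (hl : (1 <= l)%N) :
  \sum_(0 <= i < (2 * l).+1) a_coef R l i * Li (- i%:Z) x
    = ((2 * l)`!)%:R / 2%:R * (x ^+ l * (1 + x) / (1 - x) ^+ (2 * l + 1))
  /\
  \sum_(0 <= i < (2 * l + 1).+1) b_coef R l i * Li (- i%:Z) x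
    = ((2 * l + 1)`!)%:R * (x ^+ l * (1 + x) / (1 - x) ^+ (2 * l + 2)).
Proof.
split.
  (* Both choices of [s] and [m], here and for [b], make [m - s.+1] equal to [l]. *)
  rewrite (@sum_coef_Li R _ _ l.-1 (2 * l) x ((2 * l)`!%:R / 2%:R)) //.
  - by rewrite prednK// mul2n -addnn addnK addn1.
  - exact: size_a_poly.
  - by rewrite prednK// mul2n -addnn -[ltnLHS]addn0 ltn_add2l.
  - by move=> k; rewrite prednK// a_poly_nat.
rewrite (@sum_coef_Li R _ _ l (2 * l).+1 x ((2 * l + 1)`!%:R)) //.
- by rewrite subSS mul2n -addnn addnK addn2.
- exact: size_b_poly.
- by rewrite ltnS mul2n -addnn -[ltnLHS]addn0 ltn_add2l.
- by move=> k; rewrite b_poly_nat.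
Qed.
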